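(* \[ \sum_{k=1}^{\infty}(8k-1)\frac{(1)_k(-\tfrac{1}{4})_k(-\tfrac{3}{4})_k}{(\tfrac{1}{2})_k^2(\tfrac{3}{2})_k\,9^k}\sum_{i=1}^{k}\left\{\frac{1}{(2i-1)^2}-\frac{9}{4i^2}\right\}=-\frac{\sqrt{3}\,\pi^3}{108}. \]
   Context: For a complex number $x$ and a nonnegative integer $n$, $(x)_n=\Gamma(x+n)/\Gamma(x)=x(x+1)\cdots(x+n-1)$ denotes the shifted factorial (Pochhammer symbol), with $(x)_0=1$. *)

(* Defs.v *)
From Stdlib Require Import Reals.
From Coquelicot Require Import Coquelicot.
Open Scope R_scope.

Fixpoint poch (x : R) (n : nat) : R :=
  match n with
  | O => 1
  | S m => poch x m * (x + INR m)
  end.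

Definition inner_sum (k : nat) : R :=
  sum_n_m (fun i : nat => 1 / (2 * INR i - 1) ^ 2 - 9 / (4 * INR i ^ 2)) 1 k.

Definition summand (k : nat) : R :=
  (8 * INR k - 1)
  * (poch 1 k * poch (-1/4) k * poch (-3/4) k)
    / (poch (1/2) k ^ 2 * poch (3/2) k * 9 ^ k)
  * inner_sum k.

(* Main.v *)
Require Import Defs.
From Stdlib Require Import Reals Lra Lia.
From Coquelicot Require Import Coquelicot.
Open Scope R_scope.

(** Put
      [T(al,t) = sum_k (al+4k) (al-1)_{2k} (1-t)_k (1+t)_k
                 / ((2k+1)! prod_{j<k} ((al+2+3j)^2 - t^2))].
    At [al = -1/2] the factor [(1-t)_k (1+t)_k / prod_j ((3j+3/2)^2 - t^2)], divided
    by its value at [t = 0], is [1 + 4/9 inner_sum(k) t^2 + O(t^4)], so the required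
    sum is [9/2] times the coefficient of [t^2] in [T(-1/2,t)].
    A WZ pair gives [al (al+1) T(al+3,t) = ((al+2)^2 - t^2) T(al,t)], while
    [T(al,t)/al] tends to [f(t) = sum_k (1-t)_k (1+t)_k / (2k+1)!] as [al] grows, and
    the differential equation of this 2F1 at [1/4] gives
    [f(t) = 2 sin(pi t/3) / (sqrt 3 t)].  Iterating from [al = 1], where [T = 1],
    yields Euler's product for [f]; iterating from [al = -1/2] yields a cosine
    product, which the duplication [sin 2x = 2 sin x cos x] reduces to Euler's.
    The constant is fixed by the terminating case [t = 1], and
    [T(-1/2,t) = - tan(pi t/3) / (2 sqrt 3 t)]. *)

Fixpoint cubic_coef (al t : R) (k : nat) : R :=
  match k with
  | O => 1
  | S j => cubic_coef al t j
           * ((al - 1 + 2 * INR j) * (al + 2 * INR j) * ((INR j + 1) ^ 2 - t ^ 2))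
           / ((2 * INR j + 2) * (2 * INR j + 3) * ((al + 2 + 3 * INR j) ^ 2 - t ^ 2))
  end.

Definition cubic_term (al t : R) (k : nat) : R :=
  (al + 4 * INR k) * cubic_coef al t k.

Definition cubic_sum (al t : R) : R := Series (cubic_term al t).

(* The limit of [cubic_coef al t k] as [al] tends to infinity. *)
Fixpoint limit_coef (t : R) (k : nat) : R :=
  match k with
  | O => 1
  | S j => limit_coef t j * ((INR j + 1) ^ 2 - t ^ 2)
           / ((2 * INR j + 2) * (2 * INR j + 3))
  end.

(** * Dominated convergence for series *)

(** Tannery's theorem. Past some index the tail of [2 * M k], which dominates every [|u m k - v k|],
    is below [eps/2]; the finitely many earlier terms tend to 0 one by one. *)
Lemma dominated_series_lim (u : nat -> nat -> R) (v M : nat -> R) :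
  ex_series M ->
  (forall m k, Rabs (u m k) <= M k) ->
  (forall k, is_lim_seq (fun m => u m k) (v k)) ->
  ex_series v /\ is_lim_seq (fun m => Series (u m)) (Series v).
Proof.
intros HM Hu Hv.
assert (Hvb : forall k, Rabs (v k) <= M k).
{ intros k.
  apply (is_lim_seq_le (fun m => Rabs (u m k)) (fun _ => M k) (Rabs (v k)) (M k)).
  - intros m; apply Hu.
  - apply (is_lim_seq_abs (fun m => u m k) (v k)), Hv.
  - apply is_lim_seq_const. }
assert (Eu : forall m, ex_series (u m)).
{ intros m; apply (ex_series_le (u m) M); [exact (Hu m) | exact HM]. }
assert (Ev : ex_series v) by (apply (ex_series_le v M); assumption).
split; [exact Ev|].
set (d := fun m k => Rabs (u m k - v k)).
assert (Hd : forall m k, 0 <= d m k <= 2 * M k).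
{ intros m k; unfold d; split; [apply Rabs_pos|].
  generalize (Rabs_triang (u m k) (- v k)); rewrite Rabs_Ropp.
  specialize (Hu m k); specialize (Hvb k); unfold Rminus; lra. }
assert (E2 : ex_series (fun k => 2 * M k))
  by (apply (ex_series_scal_l 2 M); exact HM).
assert (Ed : forall m, ex_series (d m)).
{ intros m; apply (ex_series_le (d m) (fun k => 2 * M k)); [|exact E2].
  intros k; change (norm (d m k)) with (Rabs (d m k)).
  rewrite Rabs_pos_eq; apply Hd. }
apply is_lim_seq_spec; intros eps.
assert (He : 0 < eps / 2) by (generalize (cond_pos eps); lra).
assert (HS := Series_correct _ E2).
change (is_lim_seq (sum_n (fun k => 2 * M k)) (Series (fun k => 2 * M k))) in HS.
apply is_lim_seq_spec in HS; destruct (HS (mkposreal _ He)) as [K HK]; simpl in HK.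
specialize (HK (S K) (Nat.le_succ_diag_r K)).
assert (HF : is_lim_seq (fun m => sum_f_R0 (d m) (S K)) 0).
{ generalize (S K); intros n; induction n as [|n IH]; simpl.
  - replace (Finite 0) with (Rbar_abs (v O - v O)) by (simpl; rewrite Rminus_diag, Rabs_R0; reflexivity).
    apply is_lim_seq_abs, is_lim_seq_minus'; [apply Hv|apply is_lim_seq_const].
  - replace 0 with (0 + 0) by lra.
    apply is_lim_seq_plus'; [exact IH|].
    replace (Finite 0) with (Rbar_abs (v (S n) - v (S n))) by (simpl; rewrite Rminus_diag, Rabs_R0; reflexivity).
    apply is_lim_seq_abs, is_lim_seq_minus'; [apply Hv|apply is_lim_seq_const]. }
apply is_lim_seq_spec in HF; destruct (HF (mkposreal _ He)) as [m0 Hm0]; simpl in Hm0.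
exists m0; intros m Hm; specialize (Hm0 m Hm).
rewrite <- Series_minus by auto.
apply Rle_lt_trans with (Series (d m)); [apply Series_Rabs, Ed|].
rewrite (Series_incr_n (d m) (S (S K))) by (try lia; auto).
rewrite (Series_incr_n _ (S (S K)) ltac:(lia) E2) in HK.
rewrite sum_n_Reals in HK; simpl pred in *.
assert (Ht : Series (fun k => d m (S (S K) + k)%nat)
             <= Series (fun k => 2 * M (S (S K) + k)%nat)).
{ apply Series_le; [intros n; apply Hd|].
  apply (ex_series_incr_n (fun k => 2 * M k)); exact E2. }
rewrite Rminus_0_r in Hm0.
apply Rabs_def2 in HK; apply Rabs_def2 in Hm0; simpl in *; lra.
Qed.

(** * The contiguity relation *)

Lemma cubic_den_pos (al t : R) (k : nat) :
  - (1/2) <= al -> 0 <= t <= 1 -> 0 < (al + 2 + 3 * INR k) ^ 2 - t ^ 2.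
Proof. intros Ha Ht; assert (Hk := pos_INR k); nra. Qed.

(** From [al >= -1/2] come [|al-1+2k| <= al+2+3k+t] and [|al+2k| <= al+2+3k-t], whose right sides
    multiply to the last denominator factor. The rest is at most [1/4] because
    [4 (k+1)^2 <= (2k+2)(2k+3)] up to the cancelled common factor. *)
Lemma cubic_coef_step_bound (al t : R) (k : nat) :
  - (1/2) <= al -> 0 <= t <= 1 ->
  Rabs ((al - 1 + 2 * INR k) * (al + 2 * INR k) * ((INR k + 1) ^ 2 - t ^ 2)
        / ((2 * INR k + 2) * (2 * INR k + 3) * ((al + 2 + 3 * INR k) ^ 2 - t ^ 2))) <= /4.
Proof.
intros Ha Ht; assert (Hk := pos_INR k); assert (HD := cubic_den_pos al t k Ha Ht).
set (x := INR k) in *; set (D := (al + 2 + 3 * x) ^ 2 - t ^ 2) in *.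
assert (H1 : Rabs ((al - 1 + 2 * x) * (al + 2 * x)) <= D).
{ replace D with ((al + 2 + 3 * x + t) * (al + 2 + 3 * x - t)) by (unfold D; ring).
  rewrite Rabs_mult; apply Rmult_le_compat; try apply Rabs_pos;
    apply Rabs_le; lra. }
assert (H2 : 0 <= (x + 1) ^ 2 - t ^ 2) by nra.
assert (H3 : 4 * ((x + 1) ^ 2 - t ^ 2) <= (2 * x + 2) * (2 * x + 3)) by nra.
assert (H4 : 0 < (2 * x + 2) * (2 * x + 3)) by nra.
unfold Rdiv; rewrite !Rabs_mult, Rabs_inv.
rewrite <- Rabs_mult.
rewrite (Rabs_pos_eq ((x + 1) ^ 2 - t ^ 2)) by exact H2.
rewrite (Rabs_pos_eq (_ * D)) by (apply Rmult_le_pos; lra).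
apply Rle_div_l; [apply Rlt_gt, Rmult_lt_0_compat; lra|].
apply Rle_trans with (D * ((x + 1) ^ 2 - t ^ 2)).
- apply Rmult_le_compat_r; assumption.
- nra.
Qed.

Lemma cubic_coef_bound (al t : R) (k : nat) :
  - (1/2) <= al -> 0 <= t <= 1 -> Rabs (cubic_coef al t k) <= (/4) ^ k.
Proof.
intros Ha Ht; induction k as [|k IH]; cbn [cubic_coef pow].
- rewrite Rabs_R1; lra.
- unfold Rdiv; rewrite Rmult_assoc, Rabs_mult, (Rmult_comm (/4)).
  apply Rmult_le_compat; try apply Rabs_pos; [exact IH|].
  apply cubic_coef_step_bound; assumption.
Qed.

Lemma INR_le_pow2 (k : nat) : INR k + 1 <= 2 ^ k.
Proof.
induction k as [|k IH]; [simpl; lra|].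
rewrite S_INR; cbn [pow]; assert (0 <= INR k) by apply pos_INR; lra.
Qed.

(** One of the two factors [(1/2)^k] of [(1/4)^k] pays for the linear growth through
    [k+1 <= 2^k]. *)
Lemma linear_geom_bound (c : R) (k : nat) :
  0 <= c -> (1 + c * INR k) * (/4) ^ k <= (1 + c) * (/2) ^ k.
Proof.
intros Hc; replace (/4) with (/2 * /2) by lra; rewrite Rpow_mult_distr.
assert (H2 : 0 < (/2) ^ k) by (apply pow_lt; lra).
assert (Hp : 2 ^ k * (/2) ^ k = 1) by (rewrite <- Rpow_mult_distr, Rinv_r, pow1 by lra; reflexivity).
assert (H := INR_le_pow2 k); assert (0 <= INR k) by apply pos_INR.
assert (1 + c * INR k <= (1 + c) * 2 ^ k) by nra.
apply Rle_trans with ((1 + c) * 2 ^ k * ((/2) ^ k * (/2) ^ k)); [nra|].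
right; replace ((1 + c) * 2 ^ k * ((/2) ^ k * (/2) ^ k)) with ((1 + c) * (2 ^ k * (/2) ^ k) * (/2) ^ k) by ring.
rewrite Hp; ring.
Qed.

Lemma ex_series_half_pow (c : R) : ex_series (fun k => c * (/2) ^ k).
Proof.
apply (ex_series_scal_l c (fun k => (/2) ^ k)).
apply ex_series_geom; rewrite Rabs_pos_eq; lra.
Qed.

Lemma ex_series_cubic_term (al t : R) :
  - (1/2) <= al -> 0 <= t <= 1 -> ex_series (cubic_term al t).
Proof.
intros Ha Ht.
apply (ex_series_le (cubic_term al t) (fun k => (Rabs al + 4 + 1) * (1 + 4) * (/2) ^ k));
  [|apply ex_series_half_pow].
intros k; change (norm ?x) with (Rabs x); unfold cubic_term; rewrite Rabs_mult.
assert (Hk := pos_INR k); assert (Hp := Rabs_pos al).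
apply Rle_trans with ((Rabs al + 4 + 1) * (1 + 4 * INR k) * (/4) ^ k).
- apply Rmult_le_compat; try apply Rabs_pos; [|apply cubic_coef_bound; assumption].
  apply Rle_trans with (1 := Rabs_triang _ _); rewrite (Rabs_pos_eq (4 * INR k)) by lra; nra.
- rewrite !Rmult_assoc; apply Rmult_le_compat_l; [lra|].
  apply linear_geom_bound; lra.
Qed.

(** Removing the factor [j = 0] from the denominator product at [al] leaves the product at [al+3],
    and [(al-1)_{2k+2} = (al-1) al (al+1) (al+2)_{2k} / (al+2k+1)]. Both series of the contiguity
    relation are thus expressed through the same coefficients. *)
Lemma cubic_coef_shift (al t : R) (k : nat) :
  - (1/2) <= al -> 0 <= t <= 1 ->
  ((al + 2) ^ 2 - t ^ 2) * cubic_coef al t (S k)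
  = (al - 1) * al * (al + 1) * ((INR k + 1) ^ 2 - t ^ 2)
    / ((2 * INR k + 2) * (2 * INR k + 3) * (al + 2 * INR k + 1)) * cubic_coef (al + 3) t k.
Proof.
intros Ha Ht; induction k as [|k IH].
- assert (H := cubic_den_pos al t 0 Ha Ht); simpl in *.
  field; repeat split; try lra; nra.
- assert (Hk := pos_INR k).
  assert (HD := cubic_den_pos al t (S k) Ha Ht); rewrite S_INR in HD.
  assert (HD' := cubic_den_pos (al + 3) t k ltac:(lra) Ht).
  change (cubic_coef al t (S (S k))) with
    (cubic_coef al t (S k)
     * ((al - 1 + 2 * INR (S k)) * (al + 2 * INR (S k)) * ((INR (S k) + 1) ^ 2 - t ^ 2))
     / ((2 * INR (S k) + 2) * (2 * INR (S k) + 3) * ((al + 2 + 3 * INR (S k)) ^ 2 - t ^ 2))).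
  unfold Rdiv at 1; rewrite <- !Rmult_assoc, IH; cbn [cubic_coef].
  rewrite S_INR; set (x := INR k) in *; clearbody x; generalize (cubic_coef (al + 3) t k); intros c.
  field; repeat split; try lra; nra.
Qed.

(** The right side is the WZ certificate. Once [cubic_coef_shift] expresses everything through
    [cubic_coef (al+3) t k], each induction step is a rational identity. *)
Lemma cubic_term_telescope (al t : R) (k : nat) :
  - (1/2) <= al -> 0 <= t <= 1 ->
  sum_n (fun j => al * (al + 1) * cubic_term (al + 3) t j
                  - ((al + 2) ^ 2 - t ^ 2) * cubic_term al t j) k
  = - (al * (al + 1) * ((INR k + 1) ^ 2 - t ^ 2) / (al + 2 * INR k + 1)
       * cubic_coef (al + 3) t k).
Proof.
intros Ha Ht; induction k as [|k IH].
- rewrite sum_O; unfold cubic_term; simpl.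
  match goal with |- ?a = ?b => change (@eq R a b) end; field; lra.
- rewrite sum_Sn, IH; change (plus ?a ?b) with (a + b); unfold cubic_term.
  rewrite (Rmult_comm (al + 4 * _) (cubic_coef al t (S k))), <- (Rmult_assoc (_ ^ 2 - _)), cubic_coef_shift by assumption.
  cbn [cubic_coef]; assert (Hk := pos_INR k).
  assert (HD' := cubic_den_pos (al + 3) t k ltac:(lra) Ht).
  rewrite S_INR; set (x := INR k) in *; clearbody x; generalize (cubic_coef (al + 3) t k); intros c.
  match goal with |- ?a = ?b => change (@eq R a b) end.
  field; repeat split; try lra; nra.
Qed.

Lemma cubic_sum_shift (al t : R) :
  - (1/2) <= al -> 0 <= t <= 1 ->
  al * (al + 1) * cubic_sum (al + 3) t = ((al + 2) ^ 2 - t ^ 2) * cubic_sum al t.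
Proof.
intros Ha Ht; apply Rminus_diag_uniq; unfold cubic_sum.
assert (E0 := ex_series_cubic_term al t Ha Ht).
assert (E3 := ex_series_cubic_term (al + 3) t ltac:(lra) Ht).
rewrite <- !Series_scal_l, <- Series_minus
  by (apply (ex_series_scal_l (V := R_NormedModule)); assumption).
apply is_series_unique.
match goal with |- is_series ?f ?l => change (is_lim_seq (sum_n f) (Finite l)) end.
apply (is_lim_seq_ext _ _ _ (fun k => eq_sym (cubic_term_telescope al t k Ha Ht))).
assert (Hg : forall c, is_lim_seq (fun k => c * (/2) ^ k) 0).
{ intros c; replace (Finite 0) with (Finite (c * 0)) by (f_equal; ring).
  apply (is_lim_seq_scal_l (fun k => (/2) ^ k) c 0), is_lim_seq_geom.
  rewrite Rabs_pos_eq; lra. }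
(* The certificate is at most linear in [k] times [(1/4)^k], so the telescoped sums tend to 0. *)
apply (is_lim_seq_le_le (fun k => - Rabs (al * (al + 1)) * 4 * (/2) ^ k) _
         (fun k => Rabs (al * (al + 1)) * 4 * (/2) ^ k)); [|apply Hg|apply Hg].
intros k; rewrite <- !Ropp_mult_distr_l; apply Rabs_le_between.
rewrite Rabs_Ropp, Rabs_mult; unfold Rdiv.
rewrite Rmult_assoc, Rabs_mult.
assert (Hk := pos_INR k); assert (Hb := cubic_coef_bound (al + 3) t k ltac:(lra) Ht).
assert (H1 : Rabs (((INR k + 1) ^ 2 - t ^ 2) * / (al + 2 * INR k + 1)) <= 2 * (1 + 1 * INR k)).
{ rewrite Rabs_pos_eq.
  - apply Rle_div_l; nra.
  - apply Rmult_le_pos; [nra|left; apply Rinv_0_lt_compat; lra]. }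
assert (H2 := linear_geom_bound 1 k ltac:(lra)).
rewrite !Rmult_assoc; apply Rmult_le_compat_l; [apply Rabs_pos|].
apply Rle_trans with (2 * (1 + 1 * INR k) * (/4) ^ k); [|lra].
apply Rmult_le_compat; try apply Rabs_pos; assumption.
Qed.

(** * Limits and infinite products *)

Lemma inv_affine_lim (a b : R) :
  0 < b -> is_lim_seq (fun N => / (a + b * INR N)) 0.
Proof.
intros Hb; apply (is_lim_seq_inv _ p_infty); [|discriminate].
apply (is_lim_seq_plus (fun _ => a) (fun N => b * INR N) a p_infty p_infty).
- apply is_lim_seq_const.
- replace p_infty with (Rbar_mult b p_infty)
    by (apply is_Rbar_mult_unique, is_Rbar_mult_sym, is_Rbar_mult_p_infty_pos; exact Hb).
  apply is_lim_seq_scal_l, is_lim_seq_INR.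
- reflexivity.
Qed.

Lemma cubic_coef_lim (a t : R) (k : nat) :
  - (1/2) <= a -> 0 <= t <= 1 ->
  is_lim_seq (fun N => cubic_coef (a + 3 * INR N) t k) (limit_coef t k).
Proof.
intros Ha Ht; induction k as [|k IH]; [apply is_lim_seq_const|].
assert (Hk := pos_INR k); cbn [cubic_coef limit_coef].
set (x := INR k) in *; clearbody x.
(* [r] is the part of the term ratio that depends on [al], written in [y = 1/al]; it is continuous
   at 0 with [r 0 = 1]. *)
set (r := fun y => (1 + (2 * x - 1) * y) * (1 + 2 * x * y)
                   / ((1 + (2 + 3 * x) * y) ^ 2 - (t * y) ^ 2)).
assert (Hr : is_lim_seq (fun N => r (/ (a + 3 * INR N))) (r 0)).
{ apply is_lim_seq_continuous.
  - apply continuity_pt_filterlim, (ex_derive_continuous r); unfold r; auto_derive; lra.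
  - apply inv_affine_lim; lra. }
set (c := ((x + 1) ^ 2 - t ^ 2) / ((2 * x + 2) * (2 * x + 3))).
replace (limit_coef t k * ((x + 1) ^ 2 - t ^ 2) / ((2 * x + 2) * (2 * x + 3)))
  with (limit_coef t k * (r 0 * c)) by (unfold r, c; field; lra).
apply (is_lim_seq_ext_loc (fun N => cubic_coef (a + 3 * INR N) t k * (r (/ (a + 3 * INR N)) * c))).
- exists 1%nat; intros N HN; apply le_INR in HN; change (INR 1) with 1 in HN.
  set (al := a + 3 * INR N); assert (Hal : 0 < al) by (unfold al; lra).
  clearbody al; unfold r, c; field.
  repeat split; try lra; nra.
- apply is_lim_seq_mult'; [exact IH|].
  apply is_lim_seq_mult'; [exact Hr|apply is_lim_seq_const].
Qed.

(** With [|a| >= 1/2] every [al = a+3N] stays away from 0, even from the negative start [-1/2]. Then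
    [(al+4k)/al = 1+4k/al] is at most [1+8k] in absolute value, which gives a majorant free of
    [N]. *)
Lemma cubic_sum_lim (a t : R) :
  - (1/2) <= a -> 1/2 <= Rabs a -> 0 <= t <= 1 ->
  is_lim_seq (fun N => cubic_sum (a + 3 * INR N) t / (a + 3 * INR N)) (Series (limit_coef t)).
Proof.
intros Ha Ha' Ht.
assert (Hal : forall N, - (1/2) <= a + 3 * INR N /\ 1/2 <= Rabs (a + 3 * INR N)).
{ intros [|N].
  - replace (a + 3 * INR 0) with a by (simpl; ring); split; assumption.
  - rewrite S_INR; assert (HN := pos_INR N); split; [lra|rewrite Rabs_pos_eq; lra]. }
assert (Hinv : forall N, Rabs (/ (a + 3 * INR N)) <= 2).
{ intros N; rewrite Rabs_inv; replace 2 with (/ (1/2)) by lra.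
  apply Rinv_le_contravar; [lra|apply Hal]. }
apply (is_lim_seq_ext (fun N => Series (fun k => / (a + 3 * INR N) * cubic_term (a + 3 * INR N) t k))).
{ intros N; rewrite Series_scal_l; unfold cubic_sum, Rdiv; apply Rmult_comm. }
apply (dominated_series_lim _ _ (fun k => (1 + 8) * (/2) ^ k)).
- apply ex_series_half_pow.
- intros N k; destruct (Hal N) as [H1 H2]; specialize (Hinv N); assert (Hk := pos_INR k).
  apply Rle_trans with ((1 + 8 * INR k) * (/4) ^ k); [|apply linear_geom_bound; lra].
  unfold cubic_term; rewrite <- Rmult_assoc, Rabs_mult.
  apply Rmult_le_compat; try apply Rabs_pos; [|apply cubic_coef_bound; assumption].
  assert (H0 : a + 3 * INR N <> 0) by (intros H; rewrite H, Rabs_R0 in H2; lra).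
  replace (/ (a + 3 * INR N) * (a + 3 * INR N + 4 * INR k))
    with (1 + / (a + 3 * INR N) * (4 * INR k)) by (field; exact H0).
  apply Rle_trans with (1 := Rabs_triang _ _).
  rewrite Rabs_R1, Rabs_mult, (Rabs_pos_eq (4 * INR k)) by lra; nra.
- intros k.
  apply (is_lim_seq_ext (fun N => (1 + 4 * INR k * / (a + 3 * INR N)) * cubic_coef (a + 3 * INR N) t k)).
  { intros N; unfold cubic_term; field.
    intros H; destruct (Hal N) as [_ H2]; rewrite H, Rabs_R0 in H2; lra. }
  replace (limit_coef t k) with ((1 + 4 * INR k * 0) * limit_coef t k) by ring.
  apply is_lim_seq_mult'; [|apply cubic_coef_lim; assumption].
  apply is_lim_seq_plus'; [apply is_lim_seq_const|].
  apply is_lim_seq_mult'; [apply is_lim_seq_const|].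
  apply inv_affine_lim; lra.
Qed.

(** * Finite products from iterating the contiguity relation *)

Fixpoint fprod (f : nat -> R) (n : nat) : R :=
  match n with
  | O => 1
  | S m => fprod f m * f m
  end.

(** A step from [al] to [al+3] multiplies [T(al,t)/al] by [((al+2)^2 - t^2) / ((al+1)(al+3))], with
    denominator [(al+2)^2 - 1]. Here [al = 1+3n]; in [cosine_prod], [al = 3n-1/2]. The classical
    limits are [2 sin(pi t/3) / (sqrt 3 t)] and [2 cos(pi t/3)]. *)
Definition sine_prod (t : R) : nat -> R :=
  fprod (fun n => ((3 * INR n + 3) ^ 2 - t ^ 2) / ((3 * INR n + 3) ^ 2 - 1)).

Definition cosine_prod (t : R) : nat -> R :=
  fprod (fun n => ((3 * INR n + 3/2) ^ 2 - t ^ 2) / ((3 * INR n + 3/2) ^ 2 - 1)).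

Lemma sine_prod_S (t : R) (n : nat) :
  sine_prod t (S n) = sine_prod t n * (((3 * INR n + 3) ^ 2 - t ^ 2) / ((3 * INR n + 3) ^ 2 - 1)).
Proof. reflexivity. Qed.

Lemma cosine_prod_S (t : R) (n : nat) :
  cosine_prod t (S n)
  = cosine_prod t n * (((3 * INR n + 3/2) ^ 2 - t ^ 2) / ((3 * INR n + 3/2) ^ 2 - 1)).
Proof. reflexivity. Qed.

(** The recursion propagates a zero coefficient, leaving only the term [k = 0]. At [al = 1] the
    factor [al-1] causes this for every [t]. *)
Lemma cubic_sum_terminating (al t : R) :
  cubic_coef al t 1 = 0 -> cubic_sum al t = al.
Proof.
intros H.
assert (Hz : forall k, cubic_coef al t (S k) = 0).
{ induction k as [|k IH]; [exact H|].
  change (cubic_coef al t (S (S k))) with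
    (cubic_coef al t (S k)
     * ((al - 1 + 2 * INR (S k)) * (al + 2 * INR (S k)) * ((INR (S k) + 1) ^ 2 - t ^ 2))
     / ((2 * INR (S k) + 2) * (2 * INR (S k) + 3) * ((al + 2 + 3 * INR (S k)) ^ 2 - t ^ 2))).
  rewrite IH; unfold Rdiv; ring. }
apply is_series_unique.
match goal with |- is_series ?f ?l => change (is_lim_seq (sum_n f) (Finite l)) end.
apply (is_lim_seq_ext (fun _ => al)); [|apply is_lim_seq_const].
intros n; induction n as [|n IH].
- rewrite sum_O; unfold cubic_term; simpl; ring.
- rewrite sum_Sn, <- IH; unfold cubic_term; rewrite Hz; change (plus ?a ?b) with (a + b); ring.
Qed.

Lemma cubic_sum_sine_prod (t : R) (N : nat) :
  0 <= t <= 1 -> cubic_sum (1 + 3 * INR N) t = (1 + 3 * INR N) * sine_prod t N.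
Proof.
intros Ht; induction N as [|N IH].
- rewrite cubic_sum_terminating; simpl; [unfold sine_prod; simpl; ring|].
  unfold Rdiv; ring.
- assert (HN := pos_INR N); assert (H := cubic_sum_shift (1 + 3 * INR N) t ltac:(lra) Ht).
  rewrite IH in H; rewrite S_INR, sine_prod_S.
  replace (1 + 3 * (INR N + 1)) with (1 + 3 * INR N + 3) by ring.
  apply (Rmult_eq_reg_l ((1 + 3 * INR N) * (1 + 3 * INR N + 1))); [|nra].
  rewrite H; field; nra.
Qed.

(** The start [al = -1/2] has no terminating series for general [t], so its value stays as an
    unknown, to be solved for by comparing limits. The [-1/2] on the left is the initial [al],
    cross-multiplied. *)
Lemma cubic_sum_cosine_prod (t : R) (N : nat) :
  0 <= t <= 1 ->
  - (1/2) * cubic_sum (- (1/2) + 3 * INR N) t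
  = (- (1/2) + 3 * INR N) * cosine_prod t N * cubic_sum (- (1/2)) t.
Proof.
intros Ht; induction N as [|N IH].
- replace (- (1/2) + 3 * INR 0) with (- (1/2)) by (simpl; ring).
  unfold cosine_prod; simpl; ring.
- assert (HN := pos_INR N); assert (H := cubic_sum_shift (- (1/2) + 3 * INR N) t ltac:(lra) Ht).
  rewrite S_INR, cosine_prod_S.
  replace (- (1/2) + 3 * (INR N + 1)) with (- (1/2) + 3 * INR N + 3) by ring.
  assert (H0 : - (1/2) + 3 * INR N <> 0).
  { destruct N as [|N']; [simpl; lra|rewrite S_INR; assert (H' := pos_INR N'); lra]. }
  apply (Rmult_eq_reg_l ((- (1/2) + 3 * INR N) * (- (1/2) + 3 * INR N + 1)));
    [|apply Rmult_integral_contrapositive_currified; lra].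
  transitivity (- (1/2) * ((- (1/2) + 3 * INR N) * (- (1/2) + 3 * INR N + 1)
                           * cubic_sum (- (1/2) + 3 * INR N + 3) t)); [ring|].
  rewrite H.
  transitivity (((- (1/2) + 3 * INR N + 2) ^ 2 - t ^ 2)
                * (- (1/2) * cubic_sum (- (1/2) + 3 * INR N) t)); [ring|].
  rewrite IH; field; nra.
Qed.

(** Finite form of [sin 2x = 2 sin x cos x]: [(6n+6)^2 - 4t^2] and [(6n+3)^2 - 4t^2] are four times
    the numerators in [sine_prod t] and [cosine_prod t]. The prefactor collects the normalizations
    and tends to [1/2]. *)
Lemma sine_prod_double (t : R) (N : nat) :
  sine_prod (2 * t) (2 * N)
  = (6 * INR N + 2) / (2 * (6 * INR N + 1)) * (sine_prod t N * cosine_prod t N).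
Proof.
induction N as [|N IH].
- unfold sine_prod, cosine_prod; simpl; field.
- replace (2 * S N)%nat with (S (S (2 * N))) by lia.
  rewrite !sine_prod_S, cosine_prod_S, IH, !S_INR, mult_INR; change (INR 2) with 2.
  assert (HN := pos_INR N); field; repeat split; nra.
Qed.

Lemma sine_prod_lim (t : R) :
  0 <= t <= 1 -> is_lim_seq (sine_prod t) (Series (limit_coef t)).
Proof.
intros Ht.
apply (is_lim_seq_ext (fun N => cubic_sum (1 + 3 * INR N) t / (1 + 3 * INR N))).
- intros N; rewrite cubic_sum_sine_prod by exact Ht; field; assert (HN := pos_INR N); lra.
- apply cubic_sum_lim; [lra|rewrite Rabs_R1; lra|exact Ht].
Qed.

(** * Evaluation of the limit series *)

Lemma limit_coef_bound (t : R) (k : nat) :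
  0 <= t <= 1 -> Rabs (limit_coef t k) <= (/4) ^ k.
Proof.
intros Ht; induction k as [|k IH]; cbn [limit_coef pow].
- rewrite Rabs_R1; lra.
- assert (Hk := pos_INR k); unfold Rdiv; rewrite Rmult_assoc, Rabs_mult, (Rmult_comm (/4)).
  apply Rmult_le_compat; try apply Rabs_pos; [exact IH|].
  rewrite Rabs_pos_eq; [apply Rle_div_l; nra|].
  apply Rmult_le_pos; [nra|left; apply Rinv_0_lt_compat; nra].
Qed.

Lemma limit_coef_CV_radius (t v : R) :
  0 <= t <= 1 -> Rabs v < 4 -> Rbar_lt (Rabs v) (CV_radius (limit_coef t)).
Proof.
intros Ht Hv; apply Rbar_lt_le_trans with (Finite 4); [exact Hv|].
apply CV_radius_bounded; exists 1; intros n.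
rewrite Rabs_mult, (Rabs_pos_eq (4 ^ n)) by (apply pow_le; lra).
replace 1 with ((/4) ^ n * 4 ^ n)
  by (rewrite <- Rpow_mult_distr, Rinv_l, pow1 by lra; reflexivity).
apply Rmult_le_compat_r; [apply pow_le; lra|apply limit_coef_bound, Ht].
Qed.

(** Writing [c_k] for [limit_coef t k], the coefficient of [v^k] on the left is [(2k+2)(2k+3)
    c_{k+1} - ((k+1)^2 - t^2) c_k], which vanishes by the recursion. *)
Lemma limit_series_ode (t v : R) :
  0 <= t <= 1 -> Rabs v < 4 ->
  (4 * v - v ^ 2) * PSeries (PS_derive (PS_derive (limit_coef t))) v
  + (6 - 3 * v) * PSeries (PS_derive (limit_coef t)) v
  + (t ^ 2 - 1) * PSeries (limit_coef t) v = 0.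
Proof.
intros Ht Hv; set (w := limit_coef t).
assert (R0 := limit_coef_CV_radius t v Ht Hv); fold w in R0.
assert (R1 := R0); rewrite <- CV_radius_derive in R1.
assert (R2 := R1); rewrite <- CV_radius_derive in R2.
apply CV_radius_inside, PSeries_correct in R0, R1, R2.
set (P0 := PSeries w v) in *; set (P1 := PSeries (PS_derive w) v) in *.
set (P2 := PSeries (PS_derive (PS_derive w)) v) in *.
assert (E1 := is_pseries_incr_1 _ _ _ R1); assert (E2 := is_pseries_incr_1 _ _ _ R2).
assert (E22 := is_pseries_incr_1 _ _ _ E2).
assert (H := is_pseries_plus _ _ _ _ _
  (is_pseries_plus _ _ _ _ _ (is_pseries_scal 4 _ _ _ (Rmult_comm _ _) E2)
                             (is_pseries_scal (-1) _ _ _ (Rmult_comm _ _) E22))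
  (is_pseries_plus _ _ _ _ _
    (is_pseries_plus _ _ _ _ _ (is_pseries_scal 6 _ _ _ (Rmult_comm _ _) R1)
                               (is_pseries_scal (-3) _ _ _ (Rmult_comm _ _) E1))
    (is_pseries_scal (t ^ 2 - 1) _ _ _ (Rmult_comm _ _) R0))).
apply is_pseries_unique in H.
rewrite (PSeries_ext _ (fun _ => 0)), PSeries_const_0 in H.
- unfold plus, scal in H; simpl in H; unfold mult in H; simpl in H.
  lra.
(* Coefficients 0 and 1 are treated apart: multiplying by [v] and [v^2] shifts in zeros there. *)
- intros [|[|n]]; unfold PS_plus, PS_scal, PS_incr_1, PS_derive, w; cbn [limit_coef];
    unfold plus, scal, zero; simpl; unfold mult; simpl.
  + field.
  + field.
  + destruct n; [simpl; field|].
    assert (Hn := pos_INR (S n)); set (x := INR (S n)) in *; clearbody x.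
    field; lra.
Qed.

(** The substitution [v = 4 sin^2 z] turns the equation of the series into that of a harmonic
    oscillator; the wanted value at [v = 1] sits at [z = pi/6]. *)
Lemma limit_series_sin (t : R) :
  0 <= t <= 1 -> sqrt 3 * t * Series (limit_coef t) = 2 * sin (PI * t / 3).
Proof.
intros Ht.
set (P0 := PSeries (limit_coef t)).
set (P1 := PSeries (PS_derive (limit_coef t))).
set (P2 := PSeries (PS_derive (PS_derive (limit_coef t)))).
(* [h z] equals [sin (2 t z) / (2 t)]: it satisfies [h'' = - (2 t)^2 h], [h 0 = 0], [h' 0 = 1]. *)
set (h := fun z => sin z * cos z * P0 (4 * sin z ^ 2)).
set (h1 := fun z => (cos z ^ 2 - sin z ^ 2) * P0 (4 * sin z ^ 2)
                    + 8 * (sin z ^ 2 * cos z ^ 2) * P1 (4 * sin z ^ 2)).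
assert (HPI := PI_RGT_0).
assert (Hv : forall z, 0 <= z <= PI / 6 -> Rabs (4 * sin z ^ 2) < 4).
{ intros z Hz; assert (Hc : 0 < cos z) by (apply cos_gt_0; lra).
  assert (H := sin2_cos2 z); unfold Rsqr in H.
  rewrite Rabs_pos_eq; nra. }
assert (Hh : forall z, 0 <= z <= PI / 6 -> is_derive h z (h1 z)).
{ intros z Hz; assert (R0 := limit_coef_CV_radius t _ Ht (Hv z Hz)).
  assert (D0 := is_derive_PSeries _ _ R0).
  unfold h, h1; auto_derive; [exists (P1 (4 * sin z ^ 2)); exact D0|].
  replace (Derive _ _) with (P1 (4 * sin z ^ 2)) by (symmetry; apply is_derive_unique, D0).
  change (sin z * (sin z * 1)) with (sin z ^ 2); ring. }
assert (Hh1 : forall z, 0 <= z <= PI / 6 -> is_derive h1 z (- (4 * t ^ 2) * h z)).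
{ intros z Hz; assert (R0 := limit_coef_CV_radius t _ Ht (Hv z Hz)).
  assert (D0 := is_derive_PSeries _ _ R0).
  assert (R1 := R0); rewrite <- CV_radius_derive in R1.
  assert (D1 := is_derive_PSeries _ _ R1).
  assert (O := limit_series_ode t _ Ht (Hv z Hz)).
  fold P0 P1 P2 in O.
  unfold h, h1; auto_derive.
  - split; [exists (P1 (4 * sin z ^ 2)); exact D0|].
    split; [exists (P2 (4 * sin z ^ 2)); exact D1|exact I].
  - replace (Derive (fun x => P0 x) _) with (P1 (4 * sin z ^ 2)) by (symmetry; apply is_derive_unique, D0).
    replace (Derive (fun x => P1 x) _) with (P2 (4 * sin z ^ 2)) by (symmetry; apply is_derive_unique, D1).
    change (sin z * (sin z * 1)) with (sin z ^ 2).
    assert (H := sin2_cos2 z); unfold Rsqr in H.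
    assert (Hc : cos z * cos z = 1 - sin z * sin z) by lra.
    set (s := sin z) in *; set (c := cos z) in *.
    generalize dependent (P0 (4 * s ^ 2)); generalize dependent (P1 (4 * s ^ 2)).
    generalize dependent (P2 (4 * s ^ 2)); intros.
    (* The differential equation at [v = 4 s^2], where [4v - v^2 = 16 s^2 c^2] and
       [6 - 3v = 6 (c^2 - s^2)]; [h'' + 4 t^2 h] is [4 s c] times its left side. *)
    assert (O' : 16 * s ^ 2 * (c * c) * r + 6 * (c * c - s ^ 2) * r0 + (t ^ 2 - 1) * r1 = 0)
      by (rewrite Hc, <- O; ring).
    apply Rminus_diag_uniq.
    transitivity (4 * s * c * (16 * s ^ 2 * (c * c) * r + 6 * (c * c - s ^ 2) * r0 + (t ^ 2 - 1) * r1));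
      [ring|rewrite O'; ring]. }
set (w := 2 * t).
(* Two first integrals replace a uniqueness theorem: rotating [(w h, h')] by the angle [w z] gives a
   constant vector, equal to [(0, 1)] at [z = 0]. *)
assert (Hp : w * h 0 * cos (w * 0) - h1 0 * sin (w * 0)
             = w * h (PI / 6) * cos (w * (PI / 6)) - h1 (PI / 6) * sin (w * (PI / 6))).
{ apply (eq_is_derive (fun z => w * h z * cos (w * z) - h1 z * sin (w * z))); [|lra].
  intros z Hz; specialize (Hh z Hz); specialize (Hh1 z Hz).
  auto_derive; [repeat split; eexists; eassumption|].
  replace (Derive (fun x => h x) z) with (h1 z) by (symmetry; apply is_derive_unique, Hh).
  replace (Derive (fun x => h1 x) z) with (- (4 * t ^ 2) * h z) by (symmetry; apply is_derive_unique, Hh1).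
  unfold zero, w; simpl; ring. }
assert (Hq : w * h 0 * sin (w * 0) + h1 0 * cos (w * 0)
             = w * h (PI / 6) * sin (w * (PI / 6)) + h1 (PI / 6) * cos (w * (PI / 6))).
{ apply (eq_is_derive (fun z => w * h z * sin (w * z) + h1 z * cos (w * z))); [|lra].
  intros z Hz; specialize (Hh z Hz); specialize (Hh1 z Hz).
  auto_derive; [repeat split; eexists; eassumption|].
  replace (Derive (fun x => h x) z) with (h1 z) by (symmetry; apply is_derive_unique, Hh).
  replace (Derive (fun x => h1 x) z) with (- (4 * t ^ 2) * h z) by (symmetry; apply is_derive_unique, Hh1).
  unfold zero, w; simpl; ring. }
assert (H00 : h 0 = 0) by (unfold h; rewrite sin_0; ring).
assert (H10 : h1 0 = 1).
{ unfold h1; rewrite sin_0, cos_0; replace (4 * 0 ^ 2) with 0 by ring.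
  unfold P0; rewrite PSeries_0; simpl; ring. }
rewrite Rmult_0_r, sin_0, cos_0, H00, H10 in Hp, Hq.
assert (H6 : h (PI / 6) = sqrt 3 / 4 * Series (limit_coef t)).
{ unfold h; rewrite sin_PI6, cos_PI6; replace (4 * (1 / 2) ^ 2) with 1 by field.
  unfold P0, PSeries; rewrite (Series_ext _ (limit_coef t)); [field|].
  intros n; rewrite pow1; ring. }
replace (PI * t / 3) with (w * (PI / 6)) by (unfold w; field).
assert (Hsc := sin2_cos2 (w * (PI / 6))); unfold Rsqr in Hsc.
assert (Hwh : w * h (PI / 6) = sin (w * (PI / 6))).
{ set (a := w * h (PI / 6)) in *; set (b := h1 (PI / 6)) in *.
  set (s := sin (w * (PI / 6))) in *; set (c := cos (w * (PI / 6))) in *.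
  replace a with (a * (s * s + c * c)) by (rewrite Hsc; ring).
  replace (a * (s * s + c * c)) with ((a * c - b * s) * c + (a * s + b * c) * s) by ring.
  rewrite <- Hp, <- Hq; ring. }
rewrite <- Hwh, H6; unfold w; field.
Qed.

(** * The sum at [-1/2] and its expansion at [t = 0] *)

(** The bound [t <= 1/2] keeps [2t] in the range where the sine product limit is known. *)
Lemma cubic_sum_half (t : R) :
  0 < t <= 1/2 -> cubic_sum (- (1/2)) t = - (tan (PI * t / 3) / (2 * sqrt 3 * t)).
Proof.
intros Ht; set (f := Series (limit_coef t)); set (T := cubic_sum (- (1/2)) t).
assert (HPI := PI_RGT_0).
assert (H3 : 0 < sqrt 3) by (apply sqrt_lt_R0; lra).
assert (Hf := limit_series_sin t ltac:(lra)); fold f in Hf.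
assert (Hf2 := limit_series_sin (2 * t) ltac:(lra)).
replace (PI * (2 * t) / 3) with (2 * (PI * t / 3)) in Hf2 by field.
rewrite sin_2a in Hf2; set (x := PI * t / 3) in *.
assert (Hx : 0 < x < PI / 2) by (unfold x; split; nra).
assert (Hs : 0 < sin x) by (apply sin_gt_0; lra).
assert (Hc : 0 < cos x) by (apply cos_gt_0; lra).
assert (Hf0 : 0 < f) by (apply Rmult_lt_reg_l with (sqrt 3 * t); nra).
assert (Hdouble : Series (limit_coef (2 * t)) = f * cos x).
{ apply (Rmult_eq_reg_l (sqrt 3 * (2 * t))); [|nra].
  rewrite Hf2; transitivity (2 * (sqrt 3 * t * f) * cos x); [rewrite Hf|]; ring. }
assert (Hsub : filterlim (fun N => (2 * N)%nat) eventually eventually).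
{ apply eventually_subseq; intros N; lia. }
assert (L1 := is_lim_seq_subseq _ _ _ Hsub (sine_prod_lim (2 * t) ltac:(lra))).
rewrite Hdouble in L1.
assert (HK : is_lim_seq (fun N => (6 * INR N + 2) / (2 * (6 * INR N + 1))) (1/2)).
{ apply (is_lim_seq_ext (fun N => 1/2 + 1/2 * / (1 + 6 * INR N))).
  { intros N; assert (HN := pos_INR N); field; lra. }
  replace (1/2) with (1/2 + 1/2 * 0) at 1 by field.
  apply is_lim_seq_plus'; [apply is_lim_seq_const|].
  apply is_lim_seq_mult'; [apply is_lim_seq_const|].
  apply (inv_affine_lim 1 6); lra. }
(* Both sides are limits of [sine_prod (2t) (2N) * T]: the right one directly, the left one after
   [sine_prod_double], with [cosine_prod t N * T] traded for [-1/2] times [cubic_sum al t / al] at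
   [al = 3N-1/2]. *)
assert (Heq : - (1/2) * f * (1/2 * f) = f * cos x * T).
{ assert (La := is_lim_seq_mult' _ _ _ _
    (is_lim_seq_mult' _ _ _ _ (is_lim_seq_const (- (1/2)))
       (cubic_sum_lim (- (1/2)) t ltac:(lra) ltac:(rewrite Rabs_Ropp, Rabs_pos_eq; lra) ltac:(lra)))
    (is_lim_seq_mult' _ _ _ _ HK (sine_prod_lim t ltac:(lra)))).
  assert (Lb := is_lim_seq_mult' _ _ _ _ L1 (is_lim_seq_const T)).
  assert (E := is_lim_seq_unique _ _ La).
  apply is_lim_seq_unique in Lb.
  rewrite (Lim_seq_ext _ (fun N => sine_prod (2 * t) (2 * N) * T)) in E.
  - rewrite E in Lb; injection Lb; intros H; fold f in H; lra.
  - intros N; rewrite sine_prod_double.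
    assert (Hc' := cubic_sum_cosine_prod t N ltac:(lra)); fold T in Hc'.
    unfold Rdiv at 2; rewrite <- (Rmult_assoc (- (1/2))), Hc'; field.
    assert (HN := pos_INR N); split; [lra|].
    destruct N as [|N']; [simpl; lra|rewrite S_INR; assert (H' := pos_INR N'); lra]. }
apply (Rmult_eq_reg_l (f * cos x)); [|nra].
rewrite <- Heq; unfold tan.
replace (sin x) with (sqrt 3 * t * f / 2) by lra.
field; repeat split; lra.
Qed.

(* Chosen so that [1 - t^2 * defect t j] is the ratio of the [j]-th factor of
   [cubic_coef (-1/2) t] to that of [cubic_coef (-1/2) 0]. *)
Definition defect (t : R) (j : nat) : R :=
  ((3 * INR j + 3/2) ^ 2 - (INR j + 1) ^ 2)
  / ((INR j + 1) ^ 2 * ((3 * INR j + 3/2) ^ 2 - t ^ 2)).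

Definition deformation (t : R) : nat -> R := fprod (fun j => 1 - t ^ 2 * defect t j).

Lemma deformation_S (t : R) (k : nat) :
  deformation t (S k) = deformation t k * (1 - t ^ 2 * defect t k).
Proof. reflexivity. Qed.

Lemma cubic_coef_deformation (t : R) (k : nat) :
  0 <= t <= 1 ->
  cubic_coef (- (1/2)) t k = cubic_coef (- (1/2)) 0 k * deformation t k.
Proof.
intros Ht; induction k as [|k IH]; [unfold deformation; simpl; ring|].
cbn [cubic_coef]; rewrite deformation_S, IH; unfold defect.
assert (Hk := pos_INR k); set (x := INR k) in *; clearbody x.
field; repeat split; nra.
Qed.

Lemma defect_bound (t : R) (j : nat) : 0 <= t <= 1 -> 0 <= defect t j <= 1.
Proof.
intros Ht; unfold defect; assert (Hj := pos_INR j); set (x := INR j) in *; clearbody x.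
assert (HD : 0 < (x + 1) ^ 2 * ((3 * x + 3/2) ^ 2 - t ^ 2)) by (apply Rmult_lt_0_compat; nra).
split.
- apply Rmult_le_pos; [nra|left; apply Rinv_0_lt_compat, HD].
- apply Rle_div_l; [exact HD|].
  assert (t ^ 2 <= 1) by nra; assert (1 <= (x + 1) ^ 2) by nra.
  assert (0 <= (3 * x + 3/2) ^ 2) by apply pow2_ge_0; nra.
Qed.

(** One minus a product of factors in [[0,1]] is at most the sum of their deviations from 1. The
    bound linear in [k] dominates the difference quotients in [t^2] uniformly in [t]. *)
Lemma deformation_bound (t : R) (k : nat) :
  0 <= t <= 1 -> 0 <= deformation t k <= 1 /\ 1 - deformation t k <= INR k * t ^ 2.
Proof.
intros Ht; induction k as [|k IH]; [unfold deformation; simpl; lra|].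
rewrite deformation_S, S_INR; assert (Hd := defect_bound t k Ht).
assert (0 <= t ^ 2 <= 1) by nra.
assert (0 <= t ^ 2 * defect t k <= t ^ 2) by nra.
destruct IH as [H1 H2]; split; nra.
Qed.

Lemma inner_sum_S (k : nat) :
  inner_sum (S k)
  = inner_sum k + (1 / (2 * (INR k + 1) - 1) ^ 2 - 9 / (4 * (INR k + 1) ^ 2)).
Proof.
unfold inner_sum; rewrite sum_n_Sm by lia; rewrite S_INR; reflexivity.
Qed.

(** The [t^2] coefficient of the product is minus the sum of
    [defect 0 j = 1/(j+1)^2 - 4/(9 (2j+1)^2)], and [- defect 0 j] is [4/9] times the term [i = j+1]
    of [inner_sum]. *)
Lemma deformation_lim (u : nat -> R) (k : nat) :
  (forall m, 0 < u m <= 1) -> is_lim_seq u 0 ->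
  is_lim_seq (fun m => (deformation (u m) k - 1) / u m ^ 2) (4/9 * inner_sum k).
Proof.
intros Hu Lu; induction k as [|k IH].
- apply (is_lim_seq_ext (fun _ => 0)).
  + intros m; unfold deformation; simpl; field; specialize (Hu m); lra.
  + unfold inner_sum; rewrite sum_n_m_zero by lia; unfold zero; simpl.
    rewrite Rmult_0_r; apply is_lim_seq_const.
- assert (Lr : is_lim_seq (fun m => deformation (u m) k) 1).
  { apply (is_lim_seq_le_le (fun m => 1 - INR k * u m ^ 2) _ (fun _ => 1)).
    - intros m; specialize (Hu m); destruct (deformation_bound (u m) k ltac:(lra)); lra.
    - replace (Finite 1) with (Finite (1 - INR k * (0 * (0 * 1)))) by (f_equal; ring).
      apply is_lim_seq_minus'; [apply is_lim_seq_const|].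
      apply is_lim_seq_mult'; [apply is_lim_seq_const|].
      apply is_lim_seq_mult'; [exact Lu|].
      apply is_lim_seq_mult'; [exact Lu|apply is_lim_seq_const].
    - apply is_lim_seq_const. }
  assert (Hk := pos_INR k).
  assert (Ld : is_lim_seq (fun m => defect (u m) k) (defect 0 k)).
  { apply (is_lim_seq_continuous (fun t => defect t k)); [|exact Lu].
    apply continuity_pt_filterlim, (ex_derive_continuous (fun t => defect t k)).
    unfold defect; auto_derive.
    set (x := INR k) in *; clearbody x.
    apply Rgt_not_eq, Rmult_lt_0_compat; nra. }
  apply (is_lim_seq_ext (fun m => (deformation (u m) k - 1) / u m ^ 2
                                  - deformation (u m) k * defect (u m) k)).
  { intros m; rewrite deformation_S; specialize (Hu m); field; lra. }
  replace (4/9 * inner_sum (S k)) with (4/9 * inner_sum k - 1 * defect 0 k).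
  + apply is_lim_seq_minus'; [exact IH|].
    apply is_lim_seq_mult'; assumption.
  + rewrite inner_sum_S; unfold defect; set (x := INR k) in *; clearbody x.
    field; repeat split; nra.
Qed.

(** Here [(-3/2)_{2k} = 4^k (-3/4)_k (-1/4)_k], [(2k+1)! = 4^k (1)_k (3/2)_k], and the denominator
    product is [9^k (1/2)_k^2]; the 2 comes from [8k-1 = 2 (4k-1/2)]. *)
Lemma summand_cubic_term (k : nat) :
  summand k = 2 * cubic_term (- (1/2)) 0 k * inner_sum k.
Proof.
unfold summand, cubic_term.
assert (Hpos : forall y n, 0 < y -> 0 < poch y n).
{ intros y n Hy; induction n as [|n IH]; simpl; [lra|].
  assert (Hn := pos_INR n); nra. }
replace (cubic_coef (- (1/2)) 0 k)
  with (poch 1 k * poch (-1/4) k * poch (-3/4) k / (poch (1/2) k ^ 2 * poch (3/2) k * 9 ^ k)).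
- unfold Rdiv; field.
  assert (H9 : 0 < 9 ^ k) by (apply pow_lt; lra).
  assert (H1 := Hpos (1/2) k ltac:(lra)); assert (H2 := Hpos (3/2) k ltac:(lra)).
  unfold Rdiv in *; repeat split; lra.
- induction k as [|k IH]; [simpl; field|].
  cbn [cubic_coef]; rewrite <- IH; cbn [poch].
  replace (9 ^ S k) with (9 * 9 ^ k) by reflexivity.
  assert (H9 : 0 < 9 ^ k) by (apply pow_lt; lra).
  assert (H1 := Hpos (1/2) k ltac:(lra)); assert (H2 := Hpos (3/2) k ltac:(lra)).
  set (p1 := poch (1/2) k) in *; set (p2 := poch (3/2) k) in *.
  assert (Hk := pos_INR k); set (x := INR k) in *; clearbody x p1 p2.
  field; repeat split; nra.
Qed.

(** * Third-order behaviour of the tangent at 0 *)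

Lemma tan_cubic_bound (x : R) :
  0 < x <= 1 -> Rabs ((sin x - x * cos x) / x ^ 3 - 1/3) <= x ^ 2.
Proof.
intros Hx; assert (HPI := PI2_1).
(* Index 0 selects the Taylor polynomials of degrees 3 and 5 for the sine, 2 and 4 for the cosine;
   they place [sin x - x cos x - x^3/3] between [-x^5/24] and [x^5/120]. *)
assert (Hs := sin_bound x 0 ltac:(lra) ltac:(lra)).
assert (Hc := cos_bound x 0 ltac:(lra) ltac:(lra)).
unfold sin_approx, sin_term, cos_approx, cos_term in Hs, Hc; simpl in Hs, Hc.
apply Rabs_le_between.
assert (H3 : 0 < x ^ 3) by (apply pow_lt; lra).
replace ((sin x - x * cos x) / x ^ 3 - 1/3)
  with ((sin x - x * cos x - x ^ 3 / 3) / x ^ 3) by (field; lra).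
assert (Hs' : x - x ^ 3 / 6 <= sin x <= x - x ^ 3 / 6 + x ^ 5 / 120) by lra.
assert (Hc' : 1 - x ^ 2 / 2 <= cos x <= 1 - x ^ 2 / 2 + x ^ 4 / 24) by lra.
assert (H5 : 0 < x ^ 5) by (apply pow_lt; lra).
assert (Hxc : x - x ^ 3 / 2 <= x * cos x <= x - x ^ 3 / 2 + x ^ 5 / 24).
{ replace (x - x ^ 3 / 2) with (x * (1 - x ^ 2 / 2)) by field.
  replace (x * (1 - x ^ 2 / 2) + x ^ 5 / 24) with (x * (1 - x ^ 2 / 2 + x ^ 4 / 24)) by field.
  split; apply Rmult_le_compat_l; lra. }
split.
- apply Rle_div_r; [lra|].
  replace (- x ^ 2 * x ^ 3) with (- x ^ 5) by ring; lra.
- apply Rle_div_l; [lra|].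
  replace (x ^ 2 * x ^ 3) with (x ^ 5) by ring; lra.
Qed.

Lemma tan_cubic_lim (u : nat -> R) :
  (forall m, 0 < u m <= 1) -> is_lim_seq u 0 ->
  is_lim_seq (fun m => (tan (u m) - u m) / u m ^ 3) (1/3).
Proof.
intros Hu Lu.
assert (Hcos : forall m, 0 < cos (u m)).
{ intros m; specialize (Hu m); assert (HPI := PI2_1); apply cos_gt_0; lra. }
assert (L2 : is_lim_seq (fun m => u m ^ 2) 0).
{ replace (Finite 0) with (Finite (0 * (0 * 1))) by (f_equal; ring).
  apply is_lim_seq_mult'; [exact Lu|].
  apply is_lim_seq_mult'; [exact Lu|apply is_lim_seq_const]. }
apply (is_lim_seq_ext (fun m => (1/3 + ((sin (u m) - u m * cos (u m)) / u m ^ 3 - 1/3)) / cos (u m))).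
{ intros m; unfold tan; field; specialize (Hu m); specialize (Hcos m); lra. }
replace (Finite (1/3)) with (Finite ((1/3 + 0) / cos 0)) by (f_equal; rewrite cos_0; field).
apply is_lim_seq_div'.
- apply is_lim_seq_plus'; [apply is_lim_seq_const|].
  apply is_lim_seq_abs_0.
  apply (is_lim_seq_le_le (fun _ => 0) _ (fun m => u m ^ 2)).
  + intros m; split; [apply Rabs_pos|apply tan_cubic_bound, Hu].
  + apply is_lim_seq_const.
  + exact L2.
- apply is_lim_seq_continuous; [apply continuity_cos|exact Lu].
- rewrite cos_0; lra.
Qed.

(* sum_{k>=1} summand k = - sqrt 3 * PI^3 / 108, series indexed by n = k-1. *)
Theorem theorem1p3 :
  is_series (fun n : nat => summand (S n)) (- (sqrt 3 * PI ^ 3) / 108).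
Proof.
assert (HPI := PI_RGT_0); assert (HPI4 := PI_4).
assert (H3 : 0 < sqrt 3) by (apply sqrt_lt_R0; lra).
assert (H33 : sqrt 3 * sqrt 3 = 3) by (apply sqrt_sqrt; lra).
(* A sampling sequence for [t] tending to 0, kept in [(0, 1/2]] where the closed form holds. *)
set (u := fun m : nat => / (2 + 1 * INR m)).
assert (Hu : forall m, 0 < u m <= 1/2).
{ intros m; unfold u; assert (Hm := pos_INR m); split; [apply Rinv_0_lt_compat; lra|].
  replace (1/2) with (/2) by lra; apply Rinv_le_contravar; lra. }
assert (Lu : is_lim_seq u 0) by (apply (inv_affine_lim 2 1); lra).
set (F := cubic_term (- (1/2))).
(* Difference quotients in [t^2] of the terms; their limit [F 0 k * (4/9 * inner_sum k)] is
   [2/9 * summand k]. *)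
destruct (dominated_series_lim (fun m k => (F (u m) k - F 0 k) / u m ^ 2)
            (fun k => 2/9 * summand k) (fun k => 10 * (3/4) ^ k)) as [Ev Lv].
- apply (ex_series_scal_l (V := R_NormedModule) 10 (fun k => (3/4) ^ k)).
  apply ex_series_geom; rewrite Rabs_pos_eq; lra.
- intros m k; specialize (Hu m).
  destruct (deformation_bound (u m) k ltac:(lra)) as [B1 B2].
  unfold F, cubic_term; rewrite (cubic_coef_deformation (u m) k) by lra.
  assert (Hk := pos_INR k).
  assert (Hb := cubic_coef_bound (- (1/2)) 0 k ltac:(lra) ltac:(lra)).
  assert (Hl := linear_geom_bound 4 k ltac:(lra)).
  (* Bernoulli's inequality [1 + k/2 <= (3/2)^k] turns the factor [k] into [2 (3/2)^k]; against
     [5 (1/2)^k] this yields the majorant [10 (3/4)^k]. *)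
  assert (Hp := poly k (1/2) ltac:(lra)); replace (1 + 1/2) with (3/2) in Hp by field.
  replace (((- (1/2) + 4 * INR k) * (cubic_coef (- (1/2)) 0 k * deformation (u m) k)
            - (- (1/2) + 4 * INR k) * cubic_coef (- (1/2)) 0 k) / u m ^ 2)
    with ((- (1/2) + 4 * INR k) * cubic_coef (- (1/2)) 0 k * ((deformation (u m) k - 1) / u m ^ 2))
    by (field; lra).
  rewrite !Rabs_mult.
  apply Rle_trans with ((1 + 4) * (/2) ^ k * (2 * (3/2) ^ k)).
  + apply Rmult_le_compat; [apply Rmult_le_pos; apply Rabs_pos|apply Rabs_pos| |].
    * apply Rle_trans with (2 := Hl).
      apply Rmult_le_compat; try apply Rabs_pos; [apply Rabs_le; lra|exact Hb].
    * apply Rle_trans with (INR k); [|lra].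
      assert (H2 : 0 < u m ^ 2) by (apply pow_lt; lra).
      unfold Rdiv; rewrite Rabs_mult, Rabs_inv, (Rabs_pos_eq (u m ^ 2)), Rabs_left1 by lra.
      apply Rle_div_l; lra.
  + right; replace (3/4) with (/2 * (3/2)) by field; rewrite Rpow_mult_distr; ring.
- intros k; rewrite summand_cubic_term; fold F.
  apply (is_lim_seq_ext (fun m => F 0 k * ((deformation (u m) k - 1) / u m ^ 2))).
  { intros m; specialize (Hu m); unfold F, cubic_term.
    rewrite (cubic_coef_deformation (u m) k) by lra; field; lra. }
  replace (2/9 * (2 * F 0 k * inner_sum k)) with (F 0 k * (4/9 * inner_sum k)) by field.
  apply is_lim_seq_mult'; [apply is_lim_seq_const|].
  apply deformation_lim; [|exact Lu].
  intros m; specialize (Hu m); lra.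
- set (T := fun m => - (tan (PI * u m / 3) / (2 * sqrt 3 * u m))).
  set (T0 := cubic_sum (- (1/2)) 0).
  assert (LD : is_lim_seq (fun m => (T m - T0) / u m ^ 2) (Series (fun k => 2/9 * summand k))).
  { apply is_lim_seq_ext with (2 := Lv); intros m; unfold T, T0.
    rewrite <- cubic_sum_half by apply Hu; unfold cubic_sum; fold F.
    unfold Rdiv; rewrite Series_scal_r; f_equal.
    apply Series_minus; apply ex_series_cubic_term; try lra.
    specialize (Hu m); lra. }
  set (x := fun m => PI * u m / 3).
  assert (Hx : forall m, 0 < x m <= 1).
  { intros m; specialize (Hu m); unfold x; split; nra. }
  assert (Lx : is_lim_seq x 0).
  { replace (Finite 0) with (Finite (PI / 3 * 0)) by (f_equal; ring).
    apply (is_lim_seq_ext (fun m => PI / 3 * u m)); [intros m; unfold x; field|].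
    apply is_lim_seq_mult'; [apply is_lim_seq_const|exact Lu]. }
  assert (LG := tan_cubic_lim x Hx Lx).
  set (G := fun m => (tan (x m) - x m) / x m ^ 3) in *.
  (* This is [tan x = x + x^3 G] at [x = pi t/3], inserted into the closed form. *)
  assert (HT : forall m, T m = - (PI / (6 * sqrt 3)) - PI ^ 3 / (54 * sqrt 3) * G m * u m ^ 2).
  { intros m; specialize (Hu m); unfold T, G; fold (x m).
    generalize (tan (x m)); intros y; unfold x; field; lra. }
  assert (L2 : is_lim_seq (fun m => u m ^ 2) 0).
  { replace (Finite 0) with (Finite (0 * (0 * 1))) by (f_equal; ring).
    apply is_lim_seq_mult'; [exact Lu|].
    apply is_lim_seq_mult'; [exact Lu|apply is_lim_seq_const]. }
  (* The closed form requires [t > 0]; the value at 0 follows because [T m - T0] is a convergent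
     quotient times [u m ^ 2], hence tends to 0. *)
  assert (HT0 : T0 = - (PI / (6 * sqrt 3))).
  { assert (La := is_lim_seq_mult' _ _ _ _ LD L2).
    assert (Lb := is_lim_seq_minus' _ _ _ _ (is_lim_seq_const (- (PI / (6 * sqrt 3)) - T0))
      (is_lim_seq_mult' _ _ _ _ (is_lim_seq_mult' _ _ _ _ (is_lim_seq_const (PI ^ 3 / (54 * sqrt 3))) LG) L2)).
    apply is_lim_seq_unique in La; apply is_lim_seq_unique in Lb.
    rewrite (Lim_seq_ext _ (fun m => (T m - T0) / u m ^ 2 * u m ^ 2)) in Lb.
    - rewrite La in Lb; injection Lb; lra.
    - intros m; rewrite HT; specialize (Hu m); field; lra. }
  assert (HS : Series (fun k => 2/9 * summand k) = - (PI ^ 3 / (54 * sqrt 3)) * (1/3)).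
  { assert (La := is_lim_seq_mult' _ _ _ _ (is_lim_seq_const (- (PI ^ 3 / (54 * sqrt 3)))) LG).
    apply is_lim_seq_unique in La; apply is_lim_seq_unique in LD.
    rewrite (Lim_seq_ext _ (fun m => (T m - T0) / u m ^ 2)) in La.
    - rewrite LD in La; injection La; lra.
    - intros m; rewrite HT, HT0; specialize (Hu m); field; lra. }
  assert (Es : ex_series summand).
  { apply (ex_series_ext (fun k => 9/2 * (2/9 * summand k))); [intros k; change (9/2 * (2/9 * summand k) = summand k :> R); field|].
    apply (ex_series_scal_l (V := R_NormedModule)); exact Ev. }
  (* The series found starts at [k = 0], where the empty inner sum makes the term vanish. *)
  rewrite Series_scal_l, Series_incr_1 in HS by exact Es.
  replace (summand 0) with 0 in HS.
  + replace (- (sqrt 3 * PI ^ 3) / 108) with (Series (fun n => summand (S n))).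
    * apply Series_correct; apply -> (ex_series_incr_1 summand); exact Es.
    * apply (Rmult_eq_reg_l (2/9)); [|lra].
      rewrite Rplus_0_l in HS; rewrite HS.
      replace (PI ^ 3 / (54 * sqrt 3)) with (PI ^ 3 * sqrt 3 / (54 * (sqrt 3 * sqrt 3))) by (field; lra).
      rewrite H33; field.
  + unfold summand, inner_sum; rewrite sum_n_m_zero by lia; unfold zero; simpl; ring.
Qed.
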